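(* Let $\Gamma=(X,I,J,C,D,\pi,q)$ be a repeated game form with signals and let $g:X\times I\times J\to[0,1]$ be a reward function. For a play $h=(x_1,c_1,d_1,i_1,j_1,x_2,c_2,d_2,i_2,j_2,\dots)$ let $\gamma^s(h)=\sup_{n\ge 1} g(x_n,i_n,j_n)$. Then the repeated game $(\Gamma,g)$ with the sup evaluation $\gamma^s$ has a value, i.e. $$\sup_{\sigma\in\Sigma}\inf_{\tau\in\mathcal T}\mathbb E_{\sigma,\tau}(\gamma^s)=\inf_{\tau\in\mathcal T}\sup_{\sigma\in\Sigma}\mathbb E_{\sigma,\tau}(\gamma^s).$$
   Context: For a set $Y$, $\Delta_f(Y)$ is the set of probabilities with finite support on $Y$, and $\Delta(Y)$ (for $Y$ finite) the set of probabilities on $Y$. A repeated game form with signals $\Gamma=(X,I,J,C,D,\pi,q)$ consists of a set of states $X$, two finite sets of actions $I$ (player 1) and $J$ (player 2), two sets of signals $C$ (player 1) and $D$ (player 2), an initial distribution $\pi\in\Delta_f(X\times C\times D)$ and a transition function $q:X\times I\times J\to\Delta_f(X\times C\times D)$. Play: $(x_1,c_1,d_1)$ is drawn according to $\pi$; player 1 learns $c_1$ and player 2 learns $d_1$. At each stage $n\ge1$ the players independently choose $i_n\in I$ and $j_n\in J$; then $(x_{n+1},c_{n+1},d_{n+1})$ is drawn according to $q(x_n,i_n,j_n)$, player 1 learns $c_{n+1}$, player 2 learns $d_{n+1}$. Nothing else is observed, and each player remembers his own past signals and own past actions (perfect recall). Histories of player 1 at stage $n$: $H_n^1=(C\times I)^{n-1}\times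 C$; of player 2: $H_n^2=(D\times J)^{n-1}\times D$. A behavioral strategy of player 1 is a sequence $\sigma=(\sigma_n)_{n\ge1}$ of maps $\sigma_n:H_n^1\to\Delta(I)$; of player 2, a sequence $\tau=(\tau_n)_{n\ge1}$ of maps $\tau_n:H_n^2\to\Delta(J)$. The sets of behavioral strategies are $\Sigma$ and $\mathcal T$. A pair $(\sigma,\tau)$ induces a probability $\mathbb P_{\sigma,\tau}$ on the set of plays $H_\infty=(X\times C\times D\times I\times J)^\infty$, endowed with the $\sigma$-algebra generated by the cylinders above finite histories; $\mathbb E_{\sigma,\tau}$ is the expectation. Because $\pi,q$ have finite support and $I,J$ are finite, for each $n$ there is a finite set of histories of length $n$ (independent of $(\sigma,\tau)$) carrying all the probability. *)

(* Defs.v *)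
From HB Require Import structures.
From mathcomp Require Import all_boot all_order all_algebra.
From mathcomp Require Import finmap lra.
From mathcomp Require Import all_classical all_reals all_analysis.

Set Implicit Arguments.
Unset Strict Implicit.
Unset Printing Implicit Defensive.
Import Order.TTheory GRing.Theory Num.Theory.
Local Open Scope classical_set_scope.
Local Open Scope ring_scope.

(* When Y is a finType, [fprob R Y] is the set of all probabilities on Y. *)
Record fprob (R : realType) (Y : choiceType) := FProb {
  fprob_fun :> Y -> R;
  fprob_finite : finite_set [set y | fprob_fun y != 0];
  fprob_ge0 : forall y, 0 <= fprob_fun y;
  fprob_sum1 : \sum_(y \in [set: Y]) fprob_fun y = 1
}.

(* The action sets must be nonempty for strategies to exist. *)
Record game_form (R : realType) := GameForm {
  state : choiceType;
  act1 : finType;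
  act2 : finType;
  sig1 : choiceType;
  sig2 : choiceType;
  init : fprob R (state * sig1 * sig2)%type;
  trans : state -> act1 -> act2 -> fprob R (state * sig1 * sig2)%type;
  act1_gt0 : (0 < #|act1|)%N;
  act2_gt0 : (0 < #|act2|)%N
}.

Section PlaysAndStrategies.
Context {R : realType} (G : game_form R).

(* (x_n, c_n, d_n, i_n, j_n) *)
Definition stage : Type :=
  (state G * sig1 G * sig2 G * act1 G * act2 G)%type.

Definition draw_of (s : stage) : state G * sig1 G * sig2 G := s.1.1.
Definition state_of (s : stage) : state G := s.1.1.1.1.
Definition sig1_of (s : stage) : sig1 G := s.1.1.1.2.
Definition sig2_of (s : stage) : sig2 G := s.1.1.2.
Definition act1_of (s : stage) : act1 G := s.1.2.
Definition act2_of (s : stage) : act2 G := s.2.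

(* Stages are numbered from 0: [h n] is what happens at stage n + 1. *)
Definition play : Type := nat -> stage.

(* [hist1 n] and [hist2 n] are the players' histories at stage n + 1. *)
Definition hist1 (n : nat) : Type :=
  (n.-tuple (sig1 G * act1 G) * sig1 G)%type.
Definition hist2 (n : nat) : Type :=
  (n.-tuple (sig2 G * act2 G) * sig2 G)%type.

Definition strat1 : Type := forall n, hist1 n -> fprob R (act1 G).
Definition strat2 : Type := forall n, hist2 n -> fprob R (act2 G).

Definition obs1 (h : play) (n : nat) : hist1 n :=
  ([tuple (sig1_of (h k), act1_of (h k)) | k < n], sig1_of (h n)).
Definition obs2 (h : play) (n : nat) : hist2 n :=
  ([tuple (sig2_of (h k), act2_of (h k)) | k < n], sig2_of (h n)).

Definition draw_law (h : play) (n : nat) :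
    fprob R (state G * sig1 G * sig2 G)%type :=
  if n is m.+1 then trans (state_of (h m)) (act1_of (h m)) (act2_of (h m))
  else init G.

(* Conditional probability of [h n] given [h 0], ..., [h n.-1]. *)
Definition step_prob (sigma : strat1) (tau : strat2) (h : play) (n : nat) : R :=
  draw_law h n (draw_of (h n)) *
  sigma n (obs1 h n) (act1_of (h n)) *
  tau n (obs2 h n) (act2_of (h n)).

(* The finite history above which the cylinder is taken is the list of the
   first n stages of h. *)
Definition cylinder (n : nat) (h : play) : set play :=
  [set h' | forall k, (k < n)%N -> h' k = h k].
Definition cylinders : set (set play) :=
  [set A | exists n h, A = cylinder n h].

(* If [state G] is uncountable, [sup_eval g] need not be measurable for the
   sigma-algebra generated by the cylinders, but it coincides with a measurable
   function on the plays all of whose prefixes lie in the finite supports. These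
   plays form a measurable set of probability 1, so the integral of [sup_eval g]
   (a supremum of integrals of simple functions below it) is unaffected. *)
Definition sup_eval (g : state G -> act1 G -> act2 G -> R) (h : play) : R :=
  sup (range (fun n => g (state_of (h n)) (act1_of (h n)) (act2_of (h n)))).

Lemma step_prob_ext (sigma : strat1) (tau : strat2) (h h' : play) (n : nat) :
  (forall k, (k <= n)%N -> h k = h' k) ->
  step_prob sigma tau h n = step_prob sigma tau h' n.
Proof.
move=> e; rewrite /step_prob e//.
have -> : obs1 h n = obs1 h' n.
  rewrite /obs1 e//; congr pair; apply: eq_from_tnth => k.
  by rewrite !tnth_mktuple e// ltnW.
have -> : obs2 h n = obs2 h' n.
  rewrite /obs2 e//; congr pair; apply: eq_from_tnth => k.
  by rewrite !tnth_mktuple e// ltnW.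
by congr (_ * _ * _); rewrite /draw_law; case: n e => // m ->.
Qed.

Lemma fprob_inhabited (Y : choiceType) (p : fprob R Y) : exists y : Y, True.
Proof.
apply/not_existsP => noY; have := fprob_sum1 p.
by rewrite fsbig1 => [|y _]; [move/eqP; rewrite eq_sym oner_eq0|case: (noY y)].
Qed.

Lemma stage_inhabited : exists s : stage, True.
Proof.
have [xcd _] := fprob_inhabited (init G).
have /card_gt0P[i _] := act1_gt0 G; have /card_gt0P[j _] := act2_gt0 G.
by exists (xcd, i, j).
Qed.

HB.instance Definition _ := Choice.on stage.
HB.instance Definition _ := isPointed.Build stage (projT1 (cid stage_inhabited)).
HB.instance Definition _ := Pointed.copy play (nat -> stage).

End PlaysAndStrategies.

Arguments cylinders {R} G.

Notation play_space G := (g_sigma_algebraType (cylinders G)).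

Definition is_play_prob (R : realType) (G : game_form R) (sigma : strat1 G)
    (tau : strat2 G) (P : probability (play_space G) R) : Prop :=
  forall (n : nat) (h : play G),
    P (cylinder n h) = (\prod_(k < n) step_prob sigma tau h k)%:E.

Lemma g_sigma_algebra_set0 (T : Type) (F : set (set T)) :
  <<s F >> = <<s F `|` [set set0] >>.
Proof.
apply/seteqP; split; first by apply: sub_sigma_algebra2 => A; left.
apply: smallest_sub; first exact: smallest_sigma_algebra.
by move=> A [/sub_sigma_algebra//|->]; exact: sigma_algebra0.
Qed.

Lemma is_play_prob_unique (R : realType) (G : game_form R) (sigma : strat1 G)
    (tau : strat2 G) (P Q : probability (play_space G) R) :
  is_play_prob sigma tau P -> is_play_prob sigma tau Q ->
  forall A : set (play_space G), measurable A -> P A = Q A.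
Proof.
move=> hP hQ A mA.
pose F : set (set (play_space G)) := cylinders G `|` [set set0].
have c0 (h : play G) : cylinder 0 h = setT by apply/seteqP; split.
apply: (@measure_unique _ _ _ F (fun=> setT)) => //.
- exact: g_sigma_algebra_set0.
- move=> A1 A2 [[n [h ->]]|->]; last by move=> _; rewrite set0I; right.
  move=> [[m [h' ->]]|->]; last by rewrite setI0; right.
  have [[z [zh zh']]|no] := pselect (exists z, cylinder n h z /\ cylinder m h' z).
    left; exists (maxn n m), z; apply/seteqP; split=> y /=.
      move=> [yh yh'] k; rewrite leq_max => /orP[kn|km].
        by rewrite yh// zh.
      by rewrite yh'// zh'.
    move=> yz; split=> k kn; rewrite yz ?leq_max ?kn ?orbT//; [exact: zh|exact: zh'].
  by right; apply/seteqP; split=> // y yy; case: no; exists y.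
- by move=> _; left; exists 0%N, point; rewrite c0.
- by rewrite bigcup_const//; exists 0%N.
- move=> B [[n [h ->]]|->]; last by rewrite !measure0.
  exact: etrans (hP n h) (esym (hQ n h)).
- by move=> _; apply: (@le_lt_trans _ _ 1%E); [rewrite probability_le1|rewrite ltry].
Qed.

(* Existence: plays are simulated from a uniform variable u on [0, 1[, each
   finite history being given a subinterval whose length is its probability. *)
Definition lebesgue01 (R : realType) : set (measurableTypeR R) -> \bar R :=
  mrestr (@lebesgue_measure R) (measurable_itv `[0, 1[).

HB.instance Definition _ (R : realType) := Measure.on (@lebesgue01 R).

Lemma lebesgue01T (R : realType) : @lebesgue01 R setT = 1%E.
Proof.
by rewrite /lebesgue01 /mrestr setTI lebesgue_measure_itv/= lte01 oppr0 adde0.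
Qed.

HB.instance Definition _ (R : realType) :=
  Measure_isProbability.Build _ _ _ (@lebesgue01 R) (@lebesgue01T R).

Section PlayProbExists.
Context {R : realType} {T : pointedType}.
Local Notation path := (nat -> T).
Variable p : nat -> path -> fprob R T.
Hypothesis p_ext : forall n h h', (forall k, (k < n)%N -> h k = h' k) ->
  p n h =1 p n h'.

Let supp n h : seq T := enum_fset (fset_set [set y | p n h y != 0]).

Let supp_ext n h h' : (forall k, (k < n)%N -> h k = h' k) ->
  supp n h = supp n h'.
Proof.
move=> e; rewrite /supp; congr (enum_fset (fset_set _)); apply/seteqP.
by split=> y /=; rewrite (p_ext e).
Qed.

Let supp0 n h y : y \notin supp n h -> p n h y = 0.
Proof.
rewrite /supp; move: (fprob_finite (p n h)) => fin; rewrite in_fset_set//.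
by rewrite notin_setE /= => /negP; rewrite negbK => /eqP.
Qed.

Let supp1 n h : \sum_(y <- supp n h) p n h y = 1.
Proof.
rewrite -(fprob_sum1 (p n h)) -fsbig_finite; last exact: fprob_finite.
by apply: fsbig_widen => // y [_ /= /negP]; rewrite negbK => /eqP.
Qed.

Let before (s : seq T) (f : T -> R) y := \sum_(z <- take (index y s) s) f z.

Let before_cons w (s : seq T) (f : T -> R) y :
  before (w :: s) f y = if w == y then 0 else f w + before s f y.
Proof. by rewrite /before /=; case: ifP => _ /=; rewrite ?big_nil ?big_cons. Qed.

Let before_ge0 (s : seq T) (f : T -> R) y : (forall z, 0 <= f z) -> 0 <= before s f y.
Proof. by move=> f0; apply: sumr_ge0. Qed.

Let before_le (s : seq T) (f : T -> R) y : (forall z, 0 <= f z) -> (y \notin s -> f y = 0) ->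
  before s f y + f y <= \sum_(z <- s) f z.
Proof.
move=> f0; elim: s => [|w s ih] yn.
  by rewrite /before big_nil yn// addr0.
rewrite before_cons big_cons; case: eqVneq yn => [->|wy] yn.
  by rewrite add0r lerDl sumr_ge0.
by rewrite -addrA lerD2l ih// => ys; apply: yn; rewrite inE eq_sym (negbTE wy).
Qed.

Let before_ex (s : seq T) (f : T -> R) (a x : R) : uniq s -> a <= x < a + \sum_(z <- s) f z ->
  exists2 y, y \in s & a + before s f y <= x < a + before s f y + f y.
Proof.
elim: s a => [|w s ih] a /=.
  by rewrite big_nil addr0 => _ /andP[/le_lt_trans h /h]; rewrite ltxx.
move=> /andP[ws us].
rewrite big_cons addrA => /andP[ax xa]; case: (ltP x (a + f w)) => xw.
  by exists w; rewrite ?mem_head// before_cons eqxx addr0 ax.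
have [|y ys hy] := ih (a + f w) us; first by rewrite xw.
exists y; first by rewrite inE ys orbT.
by rewrite before_cons; case: eqVneq ws => [->|_ _]; rewrite ?ys// addrA.
Qed.

Let before_uniq (s : seq T) (f : T -> R) (a x : R) y z : (forall t, 0 <= f t) ->
  (y \notin s -> f y = 0) -> (z \notin s -> f z = 0) ->
  a + before s f y <= x < a + before s f y + f y ->
  a + before s f z <= x < a + before s f z + f z -> y = z.
Proof.
move=> f0; elim: s a => [|w s ih] a yn zn.
  by rewrite /before big_nil yn// !addr0 => /andP[/le_lt_trans h /h]; rewrite ltxx.
have ge0 t := before_ge0 s t f0.
rewrite !before_cons; case: eqVneq yn => [<- _|wy yn].
  case: eqVneq zn => // wz zn /andP[_ h1] /andP[h2 _].
  by exfalso; have := ge0 z; lra.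
case: eqVneq zn => [<- _ /andP[h1 _] /andP[_ h2]|wz zn].
  by exfalso; have := ge0 y; lra.
rewrite !addrA; apply: ih => h; [apply: yn|apply: zn];
  by rewrite inE eq_sym ?(negbTE wy) ?(negbTE wz).
Qed.

Let W n (h : path) := \prod_(k < n) p k h (h k).

Let lo := fix lo n (h : path) : R := if n is m.+1
  then lo m h + before (supp m h) (fun y => W m h * p m h y) (h m) else 0.

Let W0 n h : 0 <= W n h.
Proof. by apply: prodr_ge0 => k _; exact: fprob_ge0. Qed.

Let WS n h : W n.+1 h = W n h * p n h (h n).
Proof. by rewrite /W big_ord_recr. Qed.

Let W_ext n h h' : (forall k, (k < n)%N -> h k = h' k) -> W n h = W n h'.
Proof.
move=> e; apply: eq_bigr => k _; rewrite e//; apply: p_ext => i ik.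
by apply: e; exact: ltn_trans (ltn_ord k).
Qed.

Let lo_ext n h h' : (forall k, (k < n)%N -> h k = h' k) -> lo n h = lo n h'.
Proof.
elim: n => // n ih e /=.
have e' k : (k < n)%N -> h k = h' k by move=> kn; apply: e; exact: ltnW.
rewrite (ih e') (supp_ext e') (W_ext e') e//; congr (_ + before _ _ _).
by apply/funext => y; rewrite (p_ext e').
Qed.

Let inI n h u := lo n h <= u < lo n h + W n h.

Let inI_ext n h h' u : (forall k, (k < n)%N -> h k = h' k) ->
  inI n h u = inI n h' u.
Proof. by move=> e; rewrite /inI (lo_ext e) (W_ext e). Qed.

Let Wsum n h : \sum_(y <- supp n h) W n h * p n h y = W n h.
Proof. by rewrite -mulr_sumr supp1 mulr1. Qed.

Let Wp0 n h y : 0 <= W n h * p n h y.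
Proof. by rewrite mulr_ge0// fprob_ge0. Qed.

Let Wpsupp n h y : y \notin supp n h -> W n h * p n h y = 0.
Proof. by move=> /supp0 ->; rewrite mulr0. Qed.

Let inI_S n h u : inI n.+1 h u -> inI n h u.
Proof.
rewrite /inI /= WS => /andP[h1 h2].
have b0 := before_ge0 (supp n h) (h n) (Wp0 n h).
have := before_le (Wp0 n h) (@Wpsupp n h (h n)); rewrite Wsum.
lra.
Qed.

Let inI_01 n h u : inI n h u -> 0 <= u < 1.
Proof.
elim: n => [|n ih]; last by move/inI_S.
by rewrite /inI /W big_ord0 add0r.
Qed.

Let upd (h : path) n y : path := fun k => if k == n then y else h k.

Let updE h n y k : (k < n)%N -> h k = upd h n y k.
Proof. by move=> kn; rewrite /upd ltn_eqF. Qed.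

Let inI_ex n h u : inI n h u -> exists y, inI n.+1 (upd h n y) u.
Proof.
rewrite /inI => hu; have := hu; rewrite -{1}(Wsum n h).
move=> /(before_ex (fset_uniq _))[y _ hy].
exists y; rewrite WS /=; have e := @updE h n y.
have un : upd h n y n = y by rewrite /upd eqxx.
rewrite -(lo_ext e) -(W_ext e) -(supp_ext e) -(p_ext e) un.
rewrite (_ : (fun z => _ * p n (upd h n y) z) = fun z => W n h * p n h z)//.
by apply/funext => z; rewrite (p_ext e).
Qed.

Let sim u := fix sim n : path := if n is m.+1
  then upd (sim m) m (get [set y | inI m.+1 (upd (sim m) m y) u]) else point.
Let Phi u : path := fun n => sim u n.+1 n.

Let sim_inI n (u : R) : 0 <= u < 1 -> inI n (sim u n) u.
Proof.
move=> u01; elim: n => [|n ih]; first by rewrite /inI /W big_ord0 add0r.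
by have /getPex := inI_ex ih.
Qed.

Let sim_Phi n u k : (k < n)%N -> sim u n k = Phi u k.
Proof.
elim: n => // n ih; rewrite ltnS leq_eqVlt => /predU1P[->//|kn].
by rewrite /= /upd ltn_eqF// ih.
Qed.

Let Phi_inI n (u : R) : 0 <= u < 1 -> inI n (Phi u) u.
Proof. by move=> /(sim_inI n); rewrite (inI_ext _ (@sim_Phi n u)). Qed.

Let inI_uniq n h h' u : inI n h u -> inI n h' u ->
  forall k, (k < n)%N -> h k = h' k.
Proof.
elim: n => // n ih hS hS' k.
have e := ih (inI_S hS) (inI_S hS').
rewrite ltnS leq_eqVlt => /predU1P[->|/e//].
move: hS hS'; rewrite /inI !WS /=.
rewrite -(lo_ext e) -(W_ext e) -(supp_ext e) -(p_ext e).
rewrite (_ : (fun z => _ * p n h' z) = fun z => W n h * p n h z).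
  by apply: before_uniq; [exact: Wp0|exact: Wpsupp|exact: Wpsupp].
by apply/funext => z; rewrite (p_ext e).
Qed.

Let cyl n (h : path) := [set h' : path | forall k, (k < n)%N -> h' k = h k].
Variable C : set (set path).
Hypothesis C_cyl : forall A, C A -> exists n h, A = cyl n h.

Let X (u : measurableTypeR R) : g_sigma_algebraType C :=
  if 0 <= (u : R) < 1 then Phi u else point.

Let X_cyl n h (u : R) : 0 <= u < 1 -> X u \in cyl n h = inI n h u.
Proof.
move=> u01; rewrite /X u01; apply/idP/idP; rewrite inE /=.
  by move=> e; rewrite -(inI_ext _ e); exact: Phi_inI.
by move=> hu; apply: inI_uniq hu; exact: Phi_inI.
Qed.

Let X_cylI n h : X @^-1` cyl n h `&` `[0, 1[ = [set` `[lo n h, lo n h + W n h[].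
Proof.
apply/seteqP; split=> u /=; rewrite !in_itv /=.
  by move=> [uX u01]; move: (mem_set uX); rewrite X_cyl.
by move=> hu; have u01 := inI_01 hu; split=> //; apply: set_mem; rewrite X_cyl.
Qed.

Let mX : measurable_fun setT X.
Proof.
apply: (@measurability _ _ _ _ setT X C) => // _ [_ /C_cyl[n [h ->]] <-].
rewrite setTI -(setIT (_ @^-1` _)) -(setUv `[0, 1[) setIUr X_cylI.
apply: measurableU; first exact: measurable_itv.
have [pc|npc] := pselect (cyl n h point).
  rewrite (_ : _ `&` _ = ~` `[0, 1[); 
    first by apply: measurableC; exact: measurable_itv.
  apply/seteqP; split=> [u []//|u /= u01]; split=> //=.
  by move: u01; rewrite /X in_itv /= => /negP/negbTE ->.
rewrite (_ : _ `&` _ = set0); first exact: measurable0.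
apply/seteqP; split=> // u [] /=.
by rewrite /X in_itv /= => + /negP/negbTE u01; rewrite u01.
Qed.

Lemma path_prob_exists : exists P : probability (g_sigma_algebraType C) R,
  forall n h, P [set h' | forall k, (k < n)%N -> h' k = h k] =
    (\prod_(k < n) p k h (h k))%:E.
Proof.
exists (distribution (@lebesgue01 R) (mfun_Sub (mem_set mX))) => n h.
rewrite /distribution /pushforward /= /lebesgue01 /mrestr X_cylI.
rewrite lebesgue_measure_itv /= lte_fin ltrDl lt_neqAle W0 andbT.
case: eqVneq => [w0|_] /=; first by rewrite -[in RHS]/(W n h) -w0.
by rewrite -EFinD addrAC subrr add0r.
Qed.

End PlayProbExists.

Section StageLaw.
Context {R : realType} {G : game_form R} (sigma : strat1 G) (tau : strat2 G).
Variables (n : nat) (h : play G).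

Let upd (y : stage G) : play G := fun k => if k == n then y else h k.

Definition stage_prob (y : stage G) : R := step_prob sigma tau (upd y) n.

Let c1 (y : stage G) : hist1 G n :=
  ([tuple (sig1_of (h k), act1_of (h k)) | k < n], sig1_of y).
Let c2 (y : stage G) : hist2 G n :=
  ([tuple (sig2_of (h k), act2_of (h k)) | k < n], sig2_of y).

Lemma stage_probE y : stage_prob y = draw_law h n (draw_of y) *
  sigma (c1 y) (act1_of y) * tau (c2 y) (act2_of y).
Proof.
rewrite /stage_prob /step_prob.
have un : upd y n = y by rewrite /upd eqxx.
have uk k : (k < n)%N -> upd y k = h k by move=> kn; rewrite /upd ltn_eqF.
have -> : obs1 (upd y) n = c1 y.
  rewrite /obs1 /c1 un; congr pair; apply: eq_from_tnth => k.
  by rewrite !tnth_mktuple uk.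
have -> : obs2 (upd y) n = c2 y.
  rewrite /obs2 /c2 un; congr pair; apply: eq_from_tnth => k.
  by rewrite !tnth_mktuple uk.
have -> : draw_law (upd y) n = draw_law h n.
  by rewrite /draw_law; case: n uk => // m -> //.
by rewrite un.
Qed.

Let supp : seq (state G * sig1 G * sig2 G) :=
  enum_fset (fset_set [set y | draw_law h n y != 0]).
Let stages : seq (stage G) :=
  [seq (xi, j) | xi <- [seq (x, i) | x <- supp, i <- enum (act1 G)],
                 j <- enum (act2 G)].

Let mem_supp x : draw_law h n x != 0 -> x \in supp.
Proof.
move=> hx; have fin := fprob_finite (draw_law h n).
by rewrite /supp in_fset_set// inE.
Qed.

Let uniq_stages : uniq stages.
Proof.
apply: allpairs_uniq; rewrite ?enum_uniq//; last by move=> [? ?] [? ?].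
apply: allpairs_uniq; rewrite ?enum_uniq ?fset_uniq//.
by move=> [? ?] [? ?].
Qed.

Let mem_stages y : stage_prob y != 0 -> y \in stages.
Proof.
case: y => [[xcd i] j]; rewrite stage_probE => hy.
apply/allpairsP; exists ((xcd, i), j); split; rewrite ?mem_enum//=.
apply/allpairsP; exists (xcd, i); split; rewrite ?mem_enum//=.
by apply: mem_supp; apply: contra_neq hy => h0; rewrite /draw_of/= h0 !mul0r.
Qed.

Let fprob_fin_sum (Y : finType) (q : fprob R Y) : \sum_(y : Y) q y = 1.
Proof.
rewrite -(fprob_sum1 q) -big_enum/= (fsbigE (enum Y)) ?enum_uniq//=; last first.
  by move=> y _; rewrite mem_enum.
by apply: eq_bigl => y; rewrite in_setT.
Qed.

Let stage_finite : finite_set [set y | stage_prob y != 0].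
Proof.
apply: (@sub_finite_set _ _ [set` stages]); last exact: finite_seq.
by move=> y /=; exact: mem_stages.
Qed.

Let stage_ge0 y : 0 <= stage_prob y.
Proof. by rewrite stage_probE !mulr_ge0// fprob_ge0. Qed.

Let stage_sum1 : \sum_(y \in [set: stage G]) stage_prob y = 1.
Proof.
rewrite (fsbigE stages)//; last first.
  by move=> y _; apply: contraNeq; exact: mem_stages.
under eq_bigl do rewrite in_setT.
rewrite big_allpairs big_allpairs/=.
transitivity (\sum_(x <- supp) draw_law h n x).
  apply: eq_bigr => x _.
  transitivity (\sum_(i <- enum (act1 G)) draw_law h n x *
      sigma ([tuple (sig1_of (h k), act1_of (h k)) | k < n], x.1.2) i).
    apply: eq_bigr => i _; transitivity (\sum_(j <- enum (act2 G))
        draw_law h n x * sigma ([tuple (sig1_of (h k), act1_of (h k)) | k < n], x.1.2) i *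
        tau ([tuple (sig2_of (h k), act2_of (h k)) | k < n], x.2) j).
      by apply: eq_bigr => j _; rewrite stage_probE.
    by rewrite -mulr_sumr big_enum/= fprob_fin_sum mulr1.
  by rewrite -mulr_sumr big_enum/= fprob_fin_sum mulr1.
have fin := fprob_finite (draw_law h n).
rewrite -(fprob_sum1 (draw_law h n)) -fsbig_finite//.
by apply: fsbig_widen => // y [_ /= /negP]; rewrite negbK => /eqP.
Qed.

Definition stage_law : fprob R (stage G) :=
  FProb stage_finite stage_ge0 stage_sum1.

End StageLaw.

Lemma is_play_prob_exists (R : realType) (G : game_form R) (sigma : strat1 G)
    (tau : strat2 G) :
  exists P : probability (play_space G) R, is_play_prob sigma tau P.
Proof.
have ext n (h h' : play G) : (forall k, (k < n)%N -> h k = h' k) ->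
    stage_law sigma tau n h =1 stage_law sigma tau n h'.
  move=> e y; apply: step_prob_ext => k; rewrite leq_eqVlt.
  by move=> /predU1P[->|kn]; rewrite ?eqxx// ltn_eqF// e.
have [|P hP] := path_prob_exists ext (C := cylinders G); first by [].
exists P => n h; rewrite /is_play_prob hP; congr (_%:E).
apply: eq_bigr => k _; apply: step_prob_ext => i _.
by case: eqVneq => // ->.
Qed.

(* Well-defined by [is_play_prob_unique]. *)
Definition play_prob (R : realType) (G : game_form R) (sigma : strat1 G)
    (tau : strat2 G) : probability (play_space G) R :=
  projT1 (cid (is_play_prob_exists sigma tau)).

Lemma play_probP (R : realType) (G : game_form R) (sigma : strat1 G)
    (tau : strat2 G) : is_play_prob sigma tau (play_prob sigma tau).
Proof. exact: projT2 (cid (is_play_prob_exists sigma tau)). Qed.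

(* Main.v *)
Require Import Defs.
From mathcomp Require Import all_boot all_order all_algebra.
From mathcomp Require Import finmap lra ring.
From mathcomp Require Import all_classical all_reals all_analysis measurable_realfun.
Set Implicit Arguments.
Unset Strict Implicit.
Unset Printing Implicit Defensive.
Import Order.TTheory GRing.Theory Num.Theory.
Import numFieldNormedType.Exports.
Local Open Scope classical_set_scope.
Local Open Scope ring_scope.

(** The expected payoff satisfies the hypotheses of a Fan-type minimax theorem
    on the sets of behavioral strategies themselves, although it is not bilinear
    in the probabilities that these strategies assign.

    Convexity replaced by mixing (Kuhn). By perfect recall, a player's own
    choices contribute to the probability of a finite play a factor, his
    realization weight, that depends only on his information. Given strategies
    s, s' and t in [0, 1], the strategy that at each information set averages s
    and s' with the posterior weights of a player who initially picked s with
    probability t has realization weights t w + (1 - t) w', where w and w' are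
    those of s and s' ([realization_mix]). Finite-horizon expectations are linear in each
    player's weights, so every convex combination of payoff functions of one
    player's strategies is again such a payoff function ([payoff_mix1],
    [payoff_mix2]).

    Compactness. Player 2's strategies form a compact set for pointwise
    convergence ([strategies_compact]: Tychonoff). The payoff is the increasing
    limit of the expectations of the best reward among the first n stages
    ([finite_payoff_cvg]), and each of these is a polynomial in finitely many
    coordinates of the strategy. The payoff is thus lower semicontinuous for
    player 2, the minimizer: its sublevel sets are closed ([payoff_le],
    [realization_sublevel_closed]). This is where the supremum matters, and why
    the argument is not symmetric in the players.

    Minimax. For finitely many strategies of player 1, existence of a reply of
    player 2 that is good against all of them is a finite-dimensional convexity
    fact ([finite_minimax]); compactness extends it to all strategies of
    player 1 at once ([compact_minimax]).

    The sup evaluation need not be measurable, but it agrees with a limit of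
    measurable functions on the plays that follow the finite supports, an event
    of probability 1; [cvg_integral_nonmeasurable] is the form of monotone
    convergence that this requires. *)

(** * Minimax for payoffs that are closed under mixing *)

(** A theorem of the alternative in the plane: the image of (a, b), made upward
    closed, is convex and misses the open negative quadrant, so a line with
    nonnegative coefficients separates them. The slope is found directly: each
    point with a < 0 bounds the ratio of b's weight to a's weight from below,
    each point with b < 0 bounds it from above, and these bounds are compatible. *)
Lemma alternative_weights (R : realType) (Y : Type) (S : set Y) (a b : Y -> R) :
  (forall y z (t : R), S y -> S z -> 0 <= t <= 1 -> exists2 w, S w &
     a w <= t * a y + (1 - t) * a z /\ b w <= t * b y + (1 - t) * b z) ->
  (forall y, S y -> 0 <= a y \/ 0 <= b y) ->
  exists2 t : R, 0 <= t <= 1 & forall y, S y -> 0 <= t * a y + (1 - t) * b y.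
Proof.
move=> cvx ab.
have cross y z : S y -> S z -> a y < 0 -> b z < 0 -> a y * b z <= a z * b y.
  move=> Sy Sz ay bz; rewrite leNgt; apply/negP => lt.
  have by0 : 0 <= b y by case: (ab _ Sy) => //; lra.
  have az0 : 0 <= a z by case: (ab _ Sz) => //; lra.
  have d0 : 0 < a z - b z - a y + b y by lra.
  (* The mediant of a z / - a y < - b z / b y: it lies strictly between them,
     so the mixture of y and z with this odds ratio makes both a and b negative. *)
  pose t := (a z - b z) / (a z - b z - a y + b y).
  have t1 : 1 - t = (b y - a y) / (a z - b z - a y + b y).
    by rewrite /t; field; rewrite gt_eqF.
  have [|w Sw [aw bw]] := cvx y z t Sy Sz.
    by rewrite /t divr_ge0 ?ler_pdivrMr//=; lra.
  have aw0 : t * a y + (1 - t) * a z < 0.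
    by rewrite t1 /t !(mulrAC _ _^-1) -mulrDl pmulr_llt0 ?invr_gt0//; nra.
  have bw0 : t * b y + (1 - t) * b z < 0.
    by rewrite t1 /t !(mulrAC _ _^-1) -mulrDl pmulr_llt0 ?invr_gt0//; nra.
  by case: (ab _ Sw); lra.
have [[z [Sz bz]]|nb] := pselect (exists z, S z /\ b z < 0); last first.
  exists 0; first by rewrite lexx ler01.
  move=> y Sy; rewrite mul0r add0r subr0 mul1r leNgt.
  by apply/negP => by0; apply: nb; exists y.
have bpos y : S y -> a y < 0 -> 0 < b y.
  move=> Sy ay; have := cross _ _ Sy Sz ay bz.
  have az0 : 0 <= a z by case: (ab _ Sz) => //; lra.
  by case: (ab _ Sy) => ? ?; nra.
pose A := [set - a y / b y | y in [set y | S y /\ a y < 0]].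
have [[y0 [Sy0 ay0]]|na] := pselect (exists y, S y /\ a y < 0); last first.
  exists 1; first by rewrite ler01 lexx.
  move=> y Sy; rewrite mul1r subrr mul0r addr0 leNgt.
  by apply/negP => ay; apply: na; exists y.
have ubA y : S y -> b y < 0 -> ubound A (a y / - b y).
  move=> Sy byn _ [x [Sx ax] <-]; have bx := bpos _ Sx ax.
  rewrite ler_pdivrMr// mulrAC ler_pdivlMr; last by lra.
  by have := cross _ _ Sx Sy ax byn; lra.
have A0 : A (- a y0 / b y0) by exists y0.
have hA : has_sup A by
  split; [exists (- a y0 / b y0)|exists (a z / - b z); exact: ubA].
have s0 : 0 <= sup A.
  apply: le_trans (ub_le_sup hA.2 A0).
  by rewrite divr_ge0 ?ltW ?bpos//; lra.
have d0 : 0 < 1 + sup A by lra.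
(* The odds of b against a are the least ones allowed by the points where a < 0. *)
exists (1 + sup A)^-1; first by rewrite invr_ge0 invf_le1//; lra.
move=> y Sy.
have -> : 1 - (1 + sup A)^-1 = sup A / (1 + sup A) by field; rewrite gt_eqF.
rewrite mulrAC [_^-1 * _]mulrC -mulrDl; apply: divr_ge0; last exact: ltW.
have [ay|ay] := ltP (a y) 0.
  have bY := bpos _ Sy ay.
  have : - a y / b y <= sup A by apply: (ub_le_sup hA.2); exists y.
  by rewrite ler_pdivrMr//; lra.
have [byn|byp] := ltP (b y) 0; last by rewrite addr_ge0 ?mulr_ge0//.
have : sup A <= a y / - b y by apply: ge_sup; [exact: hA.1|exact: ubA].
by rewrite ler_pdivlMr; lra.
Qed.

(** Induction on [l]: on the convex set where the first strategy [x] fails, the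
    others succeed, hence a single [x1] does; then [x] and [x1] cover all of [S]
    and [alternative_weights] says with which weights to mix them. The set [S]
    is arbitrary so that the induction can shrink it. *)
Lemma finite_minimax (R : realType) (X Y : Type) (f : X -> Y -> R) (c : R)
    (x0 : X) :
  (forall x x' (t : R), 0 <= t <= 1 -> exists x'', forall y,
     t * f x y + (1 - t) * f x' y <= f x'' y) ->
  forall (l : seq X) (S : set Y),
  (forall y z (t : R), S y -> S z -> 0 <= t <= 1 -> exists2 w, S w &
     forall x, f x w <= t * f x y + (1 - t) * f x z) ->
  (forall y, S y -> has (fun x => c <= f x y) l) ->
  exists x, forall y, S y -> c <= f x y.
Proof.
move=> ccv; elim=> [|x l ih] S cvx hl; first by exists x0 => y /hl.
have [||x1 hx1] := ih (S `&` [set y | f x y < c]).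
- move=> y z t [Sy /= ly] [Sz /= lz] t01.
  have [w Sw hw] := cvx _ _ _ Sy Sz t01; exists w => //; split=> //=.
  apply: le_lt_trans (hw x) _; have [t0|t0] := ltP 0 t.
    have : 0 < t * (c - f x y) by rewrite mulr_gt0// subr_gt0.
    have : 0 <= (1 - t) * (c - f x z) by apply: mulr_ge0; lra.
    lra.
  by have -> : t = 0 by [lra]; rewrite mul0r add0r subr0 mul1r.
- by move=> y [Sy /= ly]; have /= := hl _ Sy; rewrite leNgt ly.
have [||t t01 ht] := @alternative_weights R Y S
  (fun y => f x1 y - c) (fun y => f x y - c).
- move=> y z t Sy Sz t01; have [w Sw hw] := cvx _ _ _ Sy Sz t01.
  by exists w => //; have := hw x; have := hw x1; lra.
- move=> y Sy; have [ly|ly] := ltP (f x y) c.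
    by left; rewrite subr_ge0 hx1.
  by right; rewrite subr_ge0.
have [x2 hx2] := ccv x1 x t t01; exists x2 => y Sy.
by have := ht _ Sy; have := hx2 y; lra.
Qed.

(** By [finite_minimax] the closed sublevel sets have the finite intersection
    property; compactness gives a common point. The topology is carried by an
    embedding [e], so that [Y] may be a type of dependent functions with values
    in a type without topology. *)
Lemma compact_minimax (R : realType) (X Y : Type) (Z : topologicalType)
    (e : Y -> Z) (f : X -> Y -> R) (c : R) (x0 : X) :
  compact (range e) ->
  (forall x, exists2 C : set Z, closed C & forall y, f x y <= c <-> C (e y)) ->
  (forall x x' (t : R), 0 <= t <= 1 -> exists x'', forall y,
     t * f x y + (1 - t) * f x' y <= f x'' y) ->
  (forall y z (t : R), 0 <= t <= 1 -> exists w, forall x,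
     f x w <= t * f x y + (1 - t) * f x z) ->
  (forall x, exists y, f x y < c) ->
  exists y, forall x, f x y <= c.
Proof.
move=> cpt clo ccv cvx lt_c.
have [C hC] : {C : X -> set Z & forall x, closed (C x) /\
    forall y, f x y <= c <-> C x (e y)}.
  apply: (@choice _ _ (fun x C => closed C /\ forall y, f x y <= c <-> C (e y))).
  by move=> x; have [C ? ?] := clo x; exists C.
pose D : {classic X} -> set Z := fun x => range e `&` C x.
have finD : finI setT D.
  move=> l _; apply: contrapT => no.
  have [|||x hx] := @finite_minimax R {classic X} Y f c x0 _ (enum_fset l) setT.
  - exact: ccv.
  - by move=> y z t _ _ t01; have [w hw] := cvx y z t t01; exists w.
  - move=> y _; apply/negPn/negP => /hasPn hl; apply: no; exists (e y) => x /= xl.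
    split; first by exists y.
    by apply/(hC x).2; rewrite ltW// ltNge; exact: hl.
  - by have [y] := lt_c x; rewrite ltNge hx.
have [|p [[y _ <-] clp]] := cpt _ (finI_filter finD).
  exists (D x0); first exact: finI_from1.
  by move=> ? [].
exists y => x; apply/(hC x).2; apply: (hC x).1 => B nB.
apply: clp nB; exists (D x); first exact: finI_from1.
by move=> ? [].
Qed.

(** * One player's behavioral strategies *)

Lemma fprob_fsum (R : realType) (A : finType) (p : A -> R) :
  \sum_(a \in [set: A]) p a = \sum_a p a.
Proof.
rewrite (fsbigE (enum A)) ?enum_uniq//=.
  by rewrite big_enum_cond; apply: eq_bigl => a; rewrite in_setT.
by move=> a _; rewrite mem_enum.
Qed.

Lemma fprob_of_fun (R : realType) (A : finType) (p : A -> R) :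
  (forall a, 0 <= p a) -> \sum_a p a = 1 ->
  exists q : fprob R A, forall a, q a = p a.
Proof.
move=> p0 p1; have fin : finite_set [set a | p a != 0] by exact: finite_finset.
have s1 : \sum_(a \in [set: A]) p a = 1 by rewrite fprob_fsum.
by exists (FProb fin p0 s1).
Qed.

Lemma fprob_mix (R : realType) (A : finType) (p q : fprob R A) (r : R) :
  0 <= r <= 1 -> exists m : fprob R A, forall a, m a = r * p a + (1 - r) * q a.
Proof.
move=> r01; apply: fprob_of_fun => [a|].
  by have := fprob_ge0 p a; have := fprob_ge0 q a; nra.
rewrite big_split/= -!mulr_sumr -!fprob_fsum !fprob_sum1; lra.
Qed.

(** What follows treats both players at once. A player has perfect recall when
    his information at stage n determines his past information and actions. *)
Section Player.
Context {R : realType} {P : Type} {O : nat -> Type} {A : finType}.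
Variables (obs : P -> forall n, O n) (act : P -> nat -> A).
Hypothesis recall : forall n h h', obs h n = obs h' n ->
  forall k, (k < n)%N -> obs h k = obs h' k /\ act h k = act h' k.

(** The factor of the probability of the first n stages that is due to the
    player's own randomization. *)
Definition realization (s : forall n, O n -> fprob R A) n h : R :=
  \prod_(k < n) s k (obs h k) (act h k).

Lemma realization_ge0 s n h : 0 <= realization s n h.
Proof. by apply: prodr_ge0 => k _; exact: fprob_ge0. Qed.

(** Kuhn's argument: the mixing weights at an information set are the posterior
    probabilities of s and s' given the player's own past actions. They are well
    defined because, under perfect recall, realization weights depend only on
    the information, so any play compatible with it may be used. *)
Lemma realization_mix (s s' : forall n, O n -> fprob R A) (t : R) :
  0 <= t <= 1 -> exists m : forall n, O n -> fprob R A, forall n h,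
    realization m n h = t * realization s n h + (1 - t) * realization s' n h.
Proof.
move=> t01.
have ex n o : exists q : fprob R A, forall h, obs h n = o -> forall a,
    (t * realization s n h + (1 - t) * realization s' n h) * q a =
    t * realization s n h * s n o a + (1 - t) * realization s' n h * s' n o a.
  have [[h <-]|no] := pselect (exists h, obs h n = o); last first.
    by exists (s n o) => h ho; case: no; exists h.
  set w := t * realization s n h; set w' := (1 - t) * realization s' n h.
  have w0 : 0 <= w by rewrite mulr_ge0 ?realization_ge0//; lra.
  have w'0 : 0 <= w' by rewrite mulr_ge0 ?realization_ge0//; lra.
  have [|q hq] := fprob_mix (s n (obs h n)) (s' n (obs h n)) (r := w / (w + w')).
    have [->|ww] := eqVneq (w + w') 0; first by rewrite invr0 mulr0 lexx ler01.
    have d0 : 0 < w + w' by rewrite lt_neqAle eq_sym ww addr_ge0.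
    by rewrite divr_ge0//= ?ler_pdivrMr//; lra.
  (* If w + w' = 0 the ratio is 0 / 0 = 0, and both sides vanish whatever q is. *)
  exists q => h' hh' a.
  have same u : realization u n h' = realization u n h.
    by apply: eq_bigr => k _; have [-> ->] := recall hh' (ltn_ord k).
  rewrite !same -/w -/w' hq.
  have [ww|ww] := eqVneq (w + w') 0; last by field.
  have [-> ->] : w = 0 /\ w' = 0 by split; lra.
  by rewrite !(mul0r, addr0).
have [m hm] : {m : forall n, O n -> fprob R A & forall n h a,
    (t * realization s n h + (1 - t) * realization s' n h) * m n (obs h n) a =
    t * realization s n h * s n (obs h n) a +
    (1 - t) * realization s' n h * s' n (obs h n) a}.
  exists (fun n o => projT1 (cid (ex n o))) => n h.
  exact: projT2 (cid (ex n _)) h erefl.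
exists m => n h; elim: n => [|n ih].
  by rewrite /realization !big_ord0; lra.
have S u : realization u n.+1 h = realization u n h * u n (obs h n) (act h n).
  by rewrite /realization big_ord_recr.
by rewrite !S ih hm !mulrA.
Qed.

(** A strategy is seen as a point of a power of R, one coordinate for each
    information set and action. Information sets have no decidable equality,
    which the index set of the product must have, hence [classic]. *)
Definition strategy_space : topologicalType :=
  prod_topology ((fun=> R) : {classic {n & O n} * A} -> topologicalType).

Definition strategy_fun (s : forall n, O n -> fprob R A) : strategy_space :=
  fun noa => s (projT1 noa.1) (projT2 noa.1) noa.2.

(** Strategies are the points of a product of unit intervals that satisfy the
    closed conditions that probabilities at each information set sum to 1. *)
Lemma strategies_compact : compact (range strategy_fun).
Proof.
have -> : range strategy_fun =
  [set f : strategy_space | forall i, f i \in `[0, 1]] `&`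
  \bigcap_(no in [set: {n & O n}]) [set f : strategy_space | \sum_a f (no, a) = 1].
  apply/seteqP; split=> [_ [s _ <-]|f [f01 f1]].
    split=> [[[n o] a]|[n o] _] /=; last first.
      by have := fprob_sum1 (s n o); rewrite fprob_fsum.
    rewrite /strategy_fun/= in_itv/= fprob_ge0/= -(fprob_sum1 (s n o)) fprob_fsum.
    by rewrite (bigD1 a)//= lerDl sumr_ge0// => b _; exact: fprob_ge0.
  have ex n o : exists q : fprob R A, forall a, q a = f (existT _ n o, a).
    apply: fprob_of_fun; last exact: (f1 (existT _ n o)).
    by move=> a; have := f01 (existT _ n o, a); rewrite in_itv/= => /andP[].
  exists (fun n o => projT1 (cid (ex n o))) => //.
  apply/funext => -[[n o] a]; exact: projT2 (cid (ex n o)) a.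
apply: compact_closedI.
  exact: (@tychonoff _ (fun=> R) (fun=> `[0, 1]%classic)
    (fun=> @segment_compact _ _ _)).
apply: closed_bigI => no _.
apply: (@preimage_closed _ _ (fun f : strategy_space => \sum_a f (no, a))
  [set x | x = 1]).
  move=> f _; apply: continuous_big; first exact: add_continuous.
  by move=> a _; exact: proj_continuous.
exact: closed_eq.
Qed.

(** A finite sum of realization weights is a polynomial in finitely many
    coordinates, hence continuous. *)
Lemma realization_sublevel_closed (n : nat) (l : seq P) (w : P -> R) (c : R) :
  exists2 C : set strategy_space, closed C & forall s,
    \sum_(h <- l) w h * realization s n h <= c <-> C (strategy_fun s).
Proof.
exists [set f : strategy_space | \sum_(h <- l) w h *
    \prod_(k < n) f (existT _ (k : nat) (obs h k), act h k) <= c]; last first.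
  by [].
apply: (@preimage_closed _ _ (fun f : strategy_space => \sum_(h <- l) w h *
    \prod_(k < n) f (existT _ (k : nat) (obs h k), act h k)) [set x | x <= c]).
  move=> f _; apply: continuous_big; first exact: add_continuous.
  move=> h _ g; apply: (@continuous_comp _ _ _ (fun f : strategy_space =>
    \prod_(k < n) f (existT _ (k : nat) (obs h k), act h k)) ( *%R (w h)));
    last exact: mulrl_continuous.
  apply: continuous_big; first exact: mul_continuous.
  by move=> k _; exact: proj_continuous.
exact: closed_le.
Qed.

End Player.
(** * Integrals of functions that are measurable off a null set *)

(** The integral of a nonnegative function is a supremum over the simple
    functions below it, so monotonicity holds without measurability. *)
Lemma ge0_le_integral_nonmeasurable d (T : measurableType d) (R : realType)
    (mu : {measure set T -> \bar R}) (f1 f2 : T -> \bar R) :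
  (forall x, 0 <= f1 x)%E -> (forall x, f1 x <= f2 x)%E ->
  (\int[mu]_x f1 x <= \int[mu]_x f2 x)%E.
Proof.
move=> f10 f12; have f20 x : (0 <= f2 x)%E by apply: le_trans (f12 x).
rewrite !ge0_integralTE//; apply: le_ereal_sup => _ [h hf <-].
by exists h => // x; apply: le_trans (f12 x).
Qed.

(** Monotone convergence for a limit [f] that may fail to be measurable, provided
    that the convergence takes place on a measurable set [D] of full measure:
    [f] is squeezed between its restriction to [D] and the function equal to [f]
    on [D] and to +oo elsewhere, which are measurable with the same integral. *)
Lemma cvg_integral_nonmeasurable d (T : measurableType d) (R : realType)
    (mu : {measure set T -> \bar R}) (D : set T) (f : T -> R) (u : nat -> T -> R) :
  measurable D -> mu (~` D) = 0 -> (forall x, 0 <= f x) ->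
  (forall n, measurable_fun setT (u n)) -> (forall n x, 0 <= u n x) ->
  (forall x, D x -> {homo u^~ x : n m / (n <= m)%N >-> n <= m}) ->
  (forall x, D x -> u n x @[n --> \oo] --> f x) ->
  (\int[mu]_x (u n x)%:E)%E @[n --> \oo] --> (\int[mu]_x (f x)%:E)%E.
Proof.
move=> mD muD f0 mu_ u0 und uf.
have mC : measurable (~` D) by exact: measurableC.
have aeD (P : T -> Prop) : (forall x, D x -> P x) -> {ae mu, forall x, P x}.
  move=> DP; exists (~` D); split=> // x /= nP Dx; exact/nP/DP.
have lim_u x : D x -> (limn (fun n => (u n x)%:E) = (f x)%:E)%E.
  by move=> Dx; apply/cvg_lim => //; apply: cvg_EFin; [exact: nearW|exact: uf].
have mf : measurable_fun D (EFin \o f).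
  apply: (emeasurable_fun_cvg (fun n => EFin \o u n)).
    by move=> n; apply/measurable_EFinP; exact: measurable_funTS.
  by move=> x Dx; apply: cvg_EFin; [exact: nearW|exact: uf].
have mfD : measurable_fun setT ((EFin \o f) \_ D).
  by apply/(measurable_restrictT _ mD).
have fD : (\int[mu]_x (f x)%:E = \int[mu]_(x in D) (f x)%:E)%E.
  rewrite [RHS]integral_mkcond; apply/eqP; rewrite eq_le; apply/andP; split.
    pose top : T -> \bar R := cst +oo%E \_ (~` D).
    have mtop : measurable_fun setT top.
      by rewrite /top; apply/(measurable_restrictT _ mC); exact: measurable_cst.
    have top0 x : (0 <= top x)%E.
      by rewrite /top patchE; case: ifP => _ /=; rewrite ?leey ?lexx.
    have fD0 x : (0 <= ((EFin \o f) \_ D) x)%E.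
      by rewrite patchE; case: ifP => // _; rewrite /= lee_fin.
    apply: (@le_trans _ _ (\int[mu]_x (((EFin \o f) \_ D) x + top x))%E).
      apply: ge0_le_integral_nonmeasurable => x; first by rewrite lee_fin.
      rewrite /top !patchE in_setC; case: (x \in D) => /=; first by rewrite adde0.
      by rewrite add0e leey.
    rewrite le_eqVlt; apply/orP; left; apply/eqP.
    apply: ge0_ae_eq_integral => //.
    - exact: emeasurable_funD.
    - by move=> x _; rewrite adde_ge0.
    - by apply: aeD => x Dx _; rewrite /top !patchE in_setC mem_set//= adde0.
  apply: ge0_le_integral_nonmeasurable => x; rewrite patchE; case: ifP => _ /=.
  - by rewrite lee_fin.
  - exact: lexx.
  - by rewrite lee_fin.
  - by rewrite lee_fin.
have uD n : (\int[mu]_x (u n x)%:E = \int[mu]_(x in D) (u n x)%:E)%E.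
  have muD' : measurable_fun D (EFin \o u n).
    by apply/measurable_EFinP; exact: measurable_funTS.
  rewrite [RHS]integral_mkcond; apply: ge0_ae_eq_integral => //.
  - by apply/measurable_EFinP.
  - by apply/(measurable_restrictT _ mD).
  - by move=> x _; rewrite lee_fin.
  - by move=> x _; rewrite patchE; case: ifP => // _; rewrite lee_fin.
  - by apply: aeD => x Dx _; rewrite patchE mem_set.
rewrite fD; under eq_cvg do rewrite uD.
have <- : (\int[mu]_(x in D) limn (fun n => (u n x)%:E) =
    \int[mu]_(x in D) (f x)%:E)%E.
  by apply: eq_integral => x /set_mem /lim_u.
apply: cvg_monotone_convergence => //.
- by move=> n; apply/measurable_EFinP; exact: measurable_funTS.
- by move=> n x _; rewrite lee_fin.
Qed.

(** * The payoff as a limit of finite-horizon payoffs *)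

Section Expectation.
Context {R : realType} (G : game_form R).
Variable g : state G -> act1 G -> act2 G -> R.
Hypothesis hg : forall x i j, 0 <= g x i j <= 1.

Definition extend (h : play G) (n : nat) (s : stage G) : play G :=
  fun k => if k == n then s else h k.

(** Stages that may follow the first n stages of h. Only the chance move is
    constrained, so that the support is independent of the strategies. *)
Definition support (h : play G) (n : nat) : set (stage G) :=
  [set s | draw_law h n (draw_of s) != 0].

Lemma finite_support h n : finite_set (support h n).
Proof.
have := finite_setX (finite_setX (fprob_finite (draw_law h n))
  (@finite_finset _ [set: act1 G])) (@finite_finset _ [set: act2 G]).
by apply: sub_finite_set => -[[x i] j].
Qed.

Lemma draw_law_ext (h h' : play G) n : (forall k, (k < n)%N -> h k = h' k) ->
  draw_law h n = draw_law h' n.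
Proof. by case: n => // n e; rewrite /draw_law e. Qed.

Definition next_stages (h : play G) (n : nat) : seq (stage G) :=
  enum_fset (fset_set (support h n)).

Lemma mem_next_stages h n s : (s \in next_stages h n) = (s \in support h n).
Proof. exact: in_fset_set (finite_support h n) s. Qed.

(** The finitely many prefixes of length n that chance allows, each represented
    by the play that extends it by an arbitrary constant tail. *)
Fixpoint prefixes (n : nat) : seq (play G) :=
  if n is m.+1 then [seq extend h m s | h <- prefixes m, s <- next_stages h m]
  else [:: point].

Definition reachable (n : nat) (h : play G) : bool :=
  [forall k : 'I_n, h k \in support h k].

Lemma reachableS n h : reachable n.+1 h = reachable n h && (h n \in support h n).
Proof.
apply/forallP/andP => [H|[/forallP H hn] [k]].
  split; last exact: (H ord_max).
  by apply/forallP => k; exact: (H (widen_ord (leqnSn n) k)).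
rewrite /= ltnS leq_eqVlt => /predU1P[->//|kn].
by have := H (Ordinal kn).
Qed.

Lemma extendE h n s k : (k < n)%N -> extend h n s k = h k.
Proof. by move=> kn; rewrite /extend ltn_eqF. Qed.

Lemma extendn h n s : extend h n s n = s.
Proof. by rewrite /extend eqxx. Qed.

Lemma indic_cylinderS n h s h' :
  \1_(cylinder n.+1 (extend h n s)) h' =
    \1_(cylinder n h) h' * (h' n == s)%:R :> R.
Proof.
rewrite !indicE -natrM mulnb; congr (_%:R); congr nat_of_bool.
apply/idP/andP; rewrite !inE /=.
  move=> e; split; last by rewrite e ?ltnSn// extendn.
  by move=> k kn; rewrite e ?extendE// ltnW.
move=> [e /eqP hs] k; rewrite ltnS leq_eqVlt.
by move=> /predU1P[->|kn]; rewrite ?extendn// extendE// e.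
Qed.

(** At most one listed prefix is a prefix of h', and there is one exactly when h'
    is reachable. Everything about the list of prefixes is used through this
    identity: with phi = 1 it shows that reachability is measurable, with phi
    the best reward so far that this reward is measurable on reachable plays. *)
Lemma sum_prefixes (phi : play G -> R) n :
  (forall h h', (forall k, (k < n)%N -> h k = h' k) -> phi h = phi h') ->
  forall h', \sum_(h <- prefixes n) phi h * \1_(cylinder n h) h' =
    phi h' * (reachable n h')%:R.
Proof.
elim: n phi => [|n ih] phi ext h' /=.
  rewrite big_seq1 indicE mem_set// (ext _ h')// /reachable.
  by have -> : [forall k : 'I_0, h' k \in support h' k] by apply/forallP => -[].
rewrite big_allpairs_dep /=.
rewrite reachableS -mulnb natrM mulrA mulrAC.
have ext' h1 h2 : (forall k, (k < n)%N -> h1 k = h2 k) ->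
    phi (extend h1 n (h' n)) * (h' n \in support h1 n)%:R =
    phi (extend h2 n (h' n)) * (h' n \in support h2 n)%:R.
  move=> e; congr (_ * _).
    apply: ext => k; rewrite ltnS leq_eqVlt => /predU1P[->|kn].
      by rewrite !extendn.
    by rewrite !extendE// e.
  by rewrite /support (draw_law_ext e).
have := ih _ ext' h'.
have -> : phi (extend h' n (h' n)) = phi h'.
  apply: ext => k; rewrite ltnS leq_eqVlt => /predU1P[->|kn].
    by rewrite extendn.
  by rewrite extendE.
move=> <-; apply: eq_bigr => h _.
rewrite -mem_next_stages mulrAC.
under eq_bigr do rewrite indic_cylinderS mulrA mulrAC.
have [hin|hin] := boolP (h' n \in next_stages h n).
  rewrite (bigD1_seq (h' n)) ?fset_uniq//= eqxx big1 ?addr0 ?mulr1//.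
  by move=> s; rewrite eq_sym => /negbTE ->; rewrite !(mulr0, mul0r).
rewrite mulr0 big_seq big1// => s hs.
case: eqVneq => [e|_]; last by rewrite !(mulr0, mul0r).
by rewrite e hs in hin.
Qed.

Variables (sigma : strat1 G) (tau : strat2 G).
Local Notation P := (play_prob sigma tau).

Lemma sum_step_prob n h :
  \sum_(s <- next_stages h n) step_prob sigma tau (extend h n s) n = 1.
Proof.
rewrite -[RHS](fprob_sum1 (stage_law sigma tau n h)) /=.
rewrite (fsbigE (next_stages h n)) ?fset_uniq//.
  by apply: eq_bigl => s; rewrite in_setT.
move=> s _; rewrite mem_next_stages stage_probE notin_setE /support /= => /negP.
by rewrite negbK => /eqP ->; rewrite !mul0r.
Qed.

Lemma sum_prefix_prob n :
  \sum_(h <- prefixes n) \prod_(k < n) step_prob sigma tau h k = 1.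
Proof.
elim: n => [|n ih] /=; first by rewrite big_seq1 big_ord0.
rewrite big_allpairs_dep /= -[RHS]ih; apply: eq_bigr => h _.
transitivity (\prod_(k < n) step_prob sigma tau h k *
    \sum_(s <- next_stages h n) step_prob sigma tau (extend h n s) n); last first.
  by rewrite sum_step_prob mulr1.
rewrite mulr_sumr; apply: eq_bigr => s _.
rewrite big_ord_recr /=; congr (_ * _); apply: eq_bigr => k _.
by apply: step_prob_ext => i ik; rewrite extendE// (leq_ltn_trans ik).
Qed.

(** Starting from 0 is harmless because rewards are nonnegative. *)
Fixpoint max_reward (n : nat) (h : play G) : R :=
  if n is m.+1 then
    Num.max (max_reward m h) (g (state_of (h m)) (act1_of (h m)) (act2_of (h m)))
  else 0.

Definition finite_payoff n : R :=
  \sum_(h <- prefixes n) max_reward n h * \prod_(k < n) step_prob sigma tau h k.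

Lemma max_rewardS n h : max_reward n.+1 h =
  Num.max (max_reward n h) (g (state_of (h n)) (act1_of (h n)) (act2_of (h n))).
Proof. by []. Qed.

Lemma max_reward_ext n h h' : (forall k, (k < n)%N -> h k = h' k) ->
  max_reward n h = max_reward n h'.
Proof.
elim: n => //= n ih e; rewrite ih ?e// => k kn; apply: e; exact: ltnW.
Qed.

Lemma max_reward_ge0 n h : 0 <= max_reward n h.
Proof.
elim: n => [|n ih]; first by rewrite lexx.
by rewrite max_rewardS le_max ih.
Qed.

Lemma max_reward_nd h : {homo max_reward^~ h : n m / (n <= m)%N >-> n <= m}.
Proof.
apply/nondecreasing_seqP => n; by rewrite max_rewardS le_max lexx.
Qed.

Lemma reward_le_sup h n :
  g (state_of (h n)) (act1_of (h n)) (act2_of (h n)) <= sup_eval g h.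
Proof.
apply: ub_le_sup; last by exists n.
exists 1 => _ [k _ <-].
by case/andP: (hg (state_of (h k)) (act1_of (h k)) (act2_of (h k))).
Qed.

Lemma sup_eval_ge0 h : 0 <= sup_eval g h.
Proof.
apply: le_trans (reward_le_sup h 0).
by case/andP: (hg (state_of (h 0%N)) (act1_of (h 0%N)) (act2_of (h 0%N))).
Qed.

Lemma sup_eval_le1 h : sup_eval g h <= 1.
Proof.
apply: ge_sup; first by eexists; exists 0%N.
move=> _ [n _ <-].
by case/andP: (hg (state_of (h n)) (act1_of (h n)) (act2_of (h n))).
Qed.

Lemma max_reward_le_sup n h : max_reward n h <= sup_eval g h.
Proof.
elim: n => [|n ih]; first exact: sup_eval_ge0.
by rewrite max_rewardS ge_max ih reward_le_sup.
Qed.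

Lemma max_reward_cvg h : max_reward n h @[n --> \oo] --> sup_eval g h.
Proof.
have ub : ubound (range (max_reward^~ h)) (sup_eval g h).
  by move=> _ [n _ <-]; exact: max_reward_le_sup.
have -> : sup_eval g h = sup (range (max_reward^~ h)).
  apply/eqP; rewrite eq_le; apply/andP; split; last first.
    by apply: ge_sup ub; exists (max_reward 0 h), 0%N.
  apply: ge_sup; first by eexists; exists 0%N.
  move=> _ [n _ <-]; apply: (@le_trans _ _ (max_reward n.+1 h)).
    by rewrite max_rewardS le_max lexx orbT.
  by apply: ub_le_sup; [exists (sup_eval g h)|exists n.+1].
apply: nondecreasing_cvgn; first exact: max_reward_nd.
by exists (sup_eval g h).
Qed.

Lemma measurable_cylinder n h : measurable (cylinder n h : set (play_space G)).
Proof. by apply: sub_gen_smallest; exists n, h. Qed.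

Lemma measurable_prefix_sum (phi : play G -> R) n :
  measurable_fun setT (fun h' : play_space G =>
    \sum_(h <- prefixes n) phi h * \1_(cylinder n h) h' : R).
Proof.
apply: measurable_sum => h; apply: measurable_funM; first exact: measurable_cst.
by apply: measurable_indic; exact: measurable_cylinder.
Qed.

Lemma integral_prefix_sum (phi : play G -> R) n : (forall h, 0 <= phi h) ->
  (\int[P]_h' (\sum_(h <- prefixes n) phi h * \1_(cylinder n h) h')%:E)%E =
  (\sum_(h <- prefixes n) phi h * \prod_(k < n) step_prob sigma tau h k)%:E.
Proof.
move=> phi0; under eq_integral do rewrite -sumEFin.
rewrite ge0_integral_sum//; last 2 first.
- move=> h; apply/measurable_EFinP.
  apply: measurable_funM; first exact: measurable_cst.
  by apply: measurable_indic; exact: measurable_cylinder.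
- by move=> h x _; rewrite lee_fin mulr_ge0// indicE ler0n.
rewrite -sumEFin; apply: eq_bigr => h _.
under eq_integral do rewrite EFinM.
rewrite ge0_integralZl//; last 2 first.
- by apply/measurable_EFinP; apply: measurable_indic; exact: measurable_cylinder.
- by rewrite lee_fin.
rewrite integral_indic//; last exact: measurable_cylinder.
by rewrite setIT EFinM; congr (_ * _)%E; exact: play_probP.
Qed.

Definition reachable_plays : set (play_space G) :=
  \bigcap_n [set h | reachable n h].

Lemma reachable_indic n h' :
  \1_[set h | reachable n h] h' =
    \sum_(h <- prefixes n) 1 * \1_(cylinder n h) h' :> R.
Proof.
rewrite (sum_prefixes (phi := fun=> 1))// mul1r indicE; congr (_%:R).
by congr nat_of_bool; apply/idP/idP; rewrite inE.
Qed.

Lemma measurable_reachable n :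
  measurable ([set h | reachable n h] : set (play_space G)).
Proof.
have -> : [set h | reachable n h] = setT `&` (fun h' : play_space G =>
    \sum_(h <- prefixes n) 1 * \1_(cylinder n h) h' : R) @^-1` [set 1].
  apply/seteqP; split=> h /=; rewrite -reachable_indic indicE.
    by move=> hr; rewrite mem_set.
  by case=> _; case: (boolP (h \in _)) => [/set_mem//|_] /eqP; rewrite eq_sym oner_eq0.
exact: measurable_prefix_sum.
Qed.

Lemma measurable_reachable_plays : measurable reachable_plays.
Proof. by apply: bigcapT_measurable => n; exact: measurable_reachable. Qed.

(** By [sum_prefix_prob] each event that the first n stages are reachable has
    probability 1. *)
Lemma prob_unreachable : P (~` reachable_plays) = 0.
Proof.
apply/(negligibleP _ (measurableC measurable_reachable_plays)).
rewrite setC_bigcap; apply: negligible_bigcup => n.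
have mr := measurable_reachable n.
apply/(negligibleP _ (measurableC mr)).
apply: etrans (probability_setC P mr) _.
have -> : P [set h | reachable n h] = 1%E.
  rewrite -[X in P X]setIT -integral_indic//.
  under eq_integral do rewrite reachable_indic.
  rewrite integral_prefix_sum//; under eq_bigr do rewrite mul1r.
  by rewrite sum_prefix_prob.
by rewrite subee.
Qed.

(** On reachable plays the best reward of the first n stages increases to the sup
    evaluation, and its expectation is a finite sum over prefixes. *)
Lemma finite_payoff_cvg :
  (finite_payoff n)%:E @[n --> \oo] --> ('E_P[sup_eval g])%E.
Proof.
rewrite unlock.
have FE n : (finite_payoff n)%:E = (\int[P]_h
    (\sum_(h' <- prefixes n) max_reward n h' * \1_(cylinder n h') h)%:E)%E.
  by rewrite integral_prefix_sum// => h; exact: max_reward_ge0.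
under eq_cvg do rewrite FE.
have u_reach n h : \sum_(h' <- prefixes n) max_reward n h' * \1_(cylinder n h') h =
    max_reward n h * (reachable n h)%:R.
  by apply: sum_prefixes; exact: max_reward_ext.
have reach1 n h : reachable_plays h -> (reachable n h)%:R = 1 :> R.
  by move=> /(_ n I) ->.
apply: (cvg_integral_nonmeasurable measurable_reachable_plays prob_unreachable).
- exact: sup_eval_ge0.
- by move=> n; exact: measurable_prefix_sum.
- by move=> n h; rewrite u_reach mulr_ge0 ?max_reward_ge0.
- move=> h hr n m nm /=; rewrite !u_reach !reach1// !mulr1.
  exact: max_reward_nd.
- move=> h hr; under eq_cvg do rewrite u_reach reach1// mulr1.
  exact: max_reward_cvg.
Qed.

(** Each prefix of length n splits into its extensions, whose probabilities add
    up to its own and along which the best reward can only grow. *)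
Lemma finite_payoff_nd : {homo finite_payoff : n m / (n <= m)%N >-> n <= m}.
Proof.
apply/nondecreasing_seqP => n; rewrite /finite_payoff [leRHS]/= big_allpairs_dep /=.
apply: ler_sum => h _.
rewrite -[leLHS]mulr1 -[X in _ * X <= _](sum_step_prob n h) mulr_sumr.
apply: ler_sum => s _.
have step0 h' k : 0 <= step_prob sigma tau h' k.
  by rewrite /step_prob !mulr_ge0 ?fprob_ge0.
have ext k : (k < n)%N -> extend h n s k = h k by exact: extendE.
rewrite big_ord_recr /= -(max_reward_ext ext).
have -> : \prod_(k < n) step_prob sigma tau h k =
    \prod_(k < n) step_prob sigma tau (extend h n s) k.
  apply: eq_bigr => k _; apply: step_prob_ext => i ik.
  by rewrite ext// (leq_ltn_trans ik).
rewrite -mulrA; apply: ler_wpM2r; first by rewrite mulr_ge0 ?prodr_ge0.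
by rewrite le_max lexx.
Qed.

End Expectation.

(** * The value *)

Lemma mktuple_inj (T : Type) n (f f' : nat -> T) :
  [tuple f k | k < n] = [tuple f' k | k < n] -> forall k, (k < n)%N -> f k = f' k.
Proof.
move=> e k kn; have := congr1 (fun t => tnth t (Ordinal kn)) e.
by rewrite !tnth_mktuple.
Qed.

Lemma obs1_recall (R : realType) (G : game_form R) n (h h' : play G) :
  obs1 h n = obs1 h' n ->
  forall k, (k < n)%N -> obs1 h k = obs1 h' k /\ act1_of (h k) = act1_of (h' k).
Proof.
move=> e k kn.
have same := mktuple_inj (f := fun k => (sig1_of (h k), act1_of (h k)))
  (f' := fun k => (sig1_of (h' k), act1_of (h' k))) (congr1 fst e).
have [s a] := same k kn; split=> //; rewrite /obs1 s; congr pair.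
by apply: eq_from_tnth => i; rewrite !tnth_mktuple; apply: same; exact: ltn_trans kn.
Qed.

Lemma obs2_recall (R : realType) (G : game_form R) n (h h' : play G) :
  obs2 h n = obs2 h' n ->
  forall k, (k < n)%N -> obs2 h k = obs2 h' k /\ act2_of (h k) = act2_of (h' k).
Proof.
move=> e k kn.
have same := mktuple_inj (f := fun k => (sig2_of (h k), act2_of (h k)))
  (f' := fun k => (sig2_of (h' k), act2_of (h' k))) (congr1 fst e).
have [s a] := same k kn; split=> //; rewrite /obs2 s; congr pair.
by apply: eq_from_tnth => i; rewrite !tnth_mktuple; apply: same; exact: ltn_trans kn.
Qed.

Section Payoff.
Context {R : realType} (G : game_form R).
Variable g : state G -> act1 G -> act2 G -> R.
Hypothesis hg : forall x i j, 0 <= g x i j <= 1.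

Definition payoff (sigma : strat1 G) (tau : strat2 G) : R :=
  fine ('E_(play_prob sigma tau)[sup_eval g])%E.

Lemma payoffE sigma tau :
  ('E_(play_prob sigma tau)[sup_eval g])%E = (payoff sigma tau)%:E.
Proof.
rewrite /payoff fineK// unlock ge0_fin_numE; last first.
  by apply: integral_ge0 => h _; rewrite lee_fin sup_eval_ge0.
apply: (@le_lt_trans _ _ (\int[play_prob sigma tau]_h (cst 1%E h)))%E.
  apply: ge0_le_integral_nonmeasurable => h; rewrite lee_fin ?sup_eval_ge0//.
  exact: sup_eval_le1.
by rewrite integral_cst// mul1e [X in (X < _)%E]probability_setT ltry.
Qed.

Lemma payoff_cvg sigma tau :
  finite_payoff g sigma tau n @[n --> \oo] --> payoff sigma tau.
Proof.
have := @finite_payoff_cvg R G g hg sigma tau; rewrite payoffE => /fine_cvg; exact.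
Qed.

(** The payoff is a supremum of finite-horizon payoffs, so its sublevel sets are
    intersections of theirs; this is what makes them closed. *)
Lemma payoff_le sigma tau c :
  payoff sigma tau <= c <-> forall n, finite_payoff g sigma tau n <= c.
Proof.
have cv := @payoff_cvg sigma tau.
have cvF : cvgn (finite_payoff g sigma tau) by apply: cvgP cv.
rewrite -(cvg_lim _ cv)//; split=> [le n|le].
  apply: le_trans le; apply: nondecreasing_cvgn_le cvF n.
  exact: finite_payoff_nd.
by apply: limr_le => //; exact: nearW.
Qed.

Local Notation real1 := (realization (@obs1 R G) (fun h n => act1_of (h n))).
Local Notation real2 := (realization (@obs2 R G) (fun h n => act2_of (h n))).

(** The factor of the probability of a prefix that is due to chance. *)
Definition chance n (h : play G) : R := \prod_(k < n) draw_law h k (draw_of (h k)).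

(** The separation of the players' contributions, which makes the payoff linear
    in the realization weights of each of them. *)
Lemma finite_payoffE sigma tau n : finite_payoff g sigma tau n =
  \sum_(h <- prefixes G n)
    max_reward g n h * chance n h * real1 sigma n h * real2 tau n h.
Proof.
apply: eq_bigr => h _; rewrite -!mulrA; congr (_ * _).
by rewrite /chance /realization /step_prob !big_split /= mulrA.
Qed.

Lemma payoff_mix1 sigma sigma' t : 0 <= t <= 1 -> exists m, forall tau,
  payoff m tau = t * payoff sigma tau + (1 - t) * payoff sigma' tau.
Proof.
move=> t01; have [m hm] := realization_mix (@obs1_recall R G) sigma sigma' t01.
exists m => tau; apply: (cvg_unique _ (@payoff_cvg m tau)) => //.
have -> : finite_payoff g m tau = fun n =>
    t * finite_payoff g sigma tau n + (1 - t) * finite_payoff g sigma' tau n.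
  apply/funext => n; rewrite !finite_payoffE !mulr_sumr -big_split /=.
  by apply: eq_bigr => h _; rewrite hm; ring.
by apply: cvgD; apply: cvgM; (exact: cvg_cst || exact: payoff_cvg).
Qed.

Lemma payoff_mix2 tau tau' t : 0 <= t <= 1 -> exists m, forall sigma,
  payoff sigma m = t * payoff sigma tau + (1 - t) * payoff sigma tau'.
Proof.
move=> t01; have [m hm] := realization_mix (@obs2_recall R G) tau tau' t01.
exists m => sigma; apply: (cvg_unique _ (@payoff_cvg sigma m)) => //.
have -> : finite_payoff g sigma m = fun n =>
    t * finite_payoff g sigma tau n + (1 - t) * finite_payoff g sigma tau' n.
  apply/funext => n; rewrite !finite_payoffE !mulr_sumr -big_split /=.
  by apply: eq_bigr => h _; rewrite hm; ring.
by apply: cvgD; apply: cvgM; (exact: cvg_cst || exact: payoff_cvg).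
Qed.

Lemma payoff_minimax (sigma0 : strat1 G) c :
  (forall sigma, exists tau, payoff sigma tau < c) ->
  exists tau, forall sigma, payoff sigma tau <= c.
Proof.
move=> lt_c.
apply: (compact_minimax (e := @strategy_fun R (hist2 G) (act2 G)) sigma0) => //.
- exact: strategies_compact.
- move=> sigma.
  have clo n := realization_sublevel_closed (@obs2 R G) (fun h n => act2_of (h n))
    n (prefixes G n) (fun h => max_reward g n h * chance n h * real1 sigma n h) c.
  exists (\bigcap_n projT1 (cid2 (clo n))).
    by apply: closed_bigI => n _; case: (cid2 (clo n)).
  move=> tau; rewrite payoff_le; split=> [le n _|le n].
    by case: (cid2 (clo n)) => C /= _ hC; apply/hC; rewrite -finite_payoffE.
  have := le n I; case: (cid2 (clo n)) => C /= _ hC /hC.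
  by rewrite -finite_payoffE.
- by move=> s s' t /(payoff_mix1 s s')[m hm]; exists m => tau; rewrite hm.
- by move=> s s' t /(payoff_mix2 s s')[m hm]; exists m => tau; rewrite hm.
Qed.

End Payoff.

Lemma fprob_exists (R : realType) (A : finType) : (0 < #|A|)%N ->
  exists p : fprob R A, True.
Proof.
move=> /card_gt0P[a _].
have [b||p _] := @fprob_of_fun R A (fun b => (b == a)%:R).
- by rewrite ler0n.
- by rewrite (bigD1 a)//= eqxx big1 ?addr0// => b /negbTE ->.
- by exists p.
Qed.

(** Sup inf <= inf sup always. Conversely, if c exceeds the sup inf, each strategy
    of player 1 has a reply with payoff below c, and [payoff_minimax] turns these
    into a single strategy of player 2 that keeps the payoff at most c. *)
Theorem theorem3 (R : realType) (G : game_form R)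
    (g : state G -> act1 G -> act2 G -> R)
    (hg : forall x i j, 0 <= g x i j <= 1) :
  ereal_sup [set ereal_inf [set 'E_(play_prob sigma tau)[sup_eval g]%E
                            | tau in [set: strat2 G]]
            | sigma in [set: strat1 G]] =
  ereal_inf [set ereal_sup [set 'E_(play_prob sigma tau)[sup_eval g]%E
                            | sigma in [set: strat1 G]]
            | tau in [set: strat2 G]].
Proof.
have [p1 _] := fprob_exists R (act1_gt0 G).
have [p2 _] := fprob_exists R (act2_gt0 G).
pose sigma0 : strat1 G := fun _ _ => p1; pose tau0 : strat2 G := fun _ _ => p2.
apply/eqP; rewrite eq_le; apply/andP; split.
  apply: ge_ereal_sup => _ [sigma _ <-]; apply: le_ereal_inf_tmp => _ [tau _ <-].
  apply: (@le_trans _ _ 'E_(play_prob sigma tau)[sup_eval g]%E).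
    by apply: ereal_inf_lbound; exists tau.
  by apply: ereal_sup_ubound; exists sigma.
set v := ereal_sup _.
have v0 : (0 <= v)%E.
  apply: le_trans (ereal_sup_ubound (_ : _ (ereal_inf _))); last by exists sigma0.
  apply: le_ereal_inf_tmp => _ [tau _ <-].
  by rewrite unlock integral_ge0// => h _; rewrite lee_fin sup_eval_ge0.
have v_ge sigma : (ereal_inf [set 'E_(play_prob sigma tau)[sup_eval g]
    | tau in [set: strat2 G]] <= v)%E by apply: ereal_sup_ubound; exists sigma.
case: v v0 v_ge => [v _ v_ge| _ _|//]; last exact: leey.
apply/lee_addgt0Pr => e e0.
have [sigma|tau le_tau] := @payoff_minimax R G g hg sigma0 (v + e).
  apply: contrapT => no; have := v_ge sigma; apply/negP; rewrite -ltNge.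
  apply: (@lt_le_trans _ _ (v + e)%:E); first by rewrite lte_fin ltrDl.
  apply: le_ereal_inf_tmp => _ [tau _ <-]; rewrite payoffE// lee_fin leNgt.
  by apply/negP => lt; apply: no; exists tau.
apply: (@le_trans _ _ (ereal_sup [set 'E_(play_prob sigma tau)[sup_eval g]%E
    | sigma in [set: strat1 G]])).
  by apply: ereal_inf_lbound; exists tau.
by apply: ge_ereal_sup => _ [sigma _ <-]; rewrite payoffE// -EFinD lee_fin.
Qed.
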